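(* Let $\mathcal{H}$ be a real Hilbert space, let $K:\mathcal{H}\to\mathcal{H}$ be a bounded linear operator, and let $\{f_j\}_{j\in\mathbb{Z}}$ be a $K$-frame for $\mathcal{H}$ with frame operator $S$ and $K$-frame constants $A<B$. If $f_0\in\mathcal{H}$, $f_0\neq 0$, then $$-\frac{\|K^*f_0\|^2}{2A}\ \le\ \min_{v\in\mathcal{H}}J_{f_0,\sigma_S}(v)\ \le\ -\frac{7}{32}\,\frac{\|K^*f_0\|^4}{B\,\|f_0\|^2}\ \le\ -\beta\,\|K^*f_0\|^2$$ for some $\beta>0$.
   Context: A sequence $\{f_j\}_{j\in\mathbb{Z}}$ in $\mathcal{H}$ is a $K$-frame with constants $A,B>0$ if $A\|K^*f\|^2\le\sum_{j\in\mathbb{Z}}|\langle f,f_j\rangle|^2\le B\|f\|^2$ for every $f\in\mathcal{H}$. Its frame operator is $S:\mathcal{H}\to\mathcal{H}$, $Sf=\sum_{j\in\mathbb{Z}}\langle f,f_j\rangle f_j$. Define the bilinear form $\sigma_S(u,v)=\langle Su,v\rangle$ and, for $f_0\in\mathcal{H}$, the function $J_{f_0,\sigma_S}:\mathcal{H}\to\mathbb{R}$, $J_{f_0,\sigma_S}(v)=\frac12\sigma_S(v,v)-\langle KK^*f_0,v\rangle$.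
   Formalization: The minimum of J over H is replaced by its infimum (shown to be finite), since the minimum need not be attained, e.g. in ℓ² with f_j = e_j/j, Kv = ⟨v,e⟩g, g = f_0 = (1/j²); when it is attained the two agree. *)

(* Defs.v *)
From HB Require Import structures.
From mathcomp Require Import all_boot all_order all_algebra sesquilinear.
From mathcomp Require Import boolp classical_sets reals ereal topology normedtype.
From mathcomp Require Import sequences esum.
From mathcomp Require Import showcase.summability.

Set Implicit Arguments.
Unset Strict Implicit.
Unset Printing Implicit Defensive.

Import Order.TTheory GRing.Theory Num.Theory.
Import numFieldNormedType.Exports.

Local Open Scope classical_set_scope.
Local Open Scope ring_scope.

HB.mixin Record NormedModule_hasInner (R : realType) H
    & NormedModule R H := {
  inner : {dot H for idfun} ;
  innerE : forall x : H, inner x x = `|x| ^+ 2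
}.

#[short(type="hilbertType")]
HB.structure Definition Hilbert (R : realType) :=
  {H of CompleteNormedModule R H & NormedModule_hasInner R H}.

Notation "''[' u , v ]" := (inner u v) : ring_scope.

Section KFrame.
Context (R : realType) (H : hilbertType R).
Implicit Types (K S : H -> H) (f : int -> H) (u v x : H).

Definition bounded_operator K := exists M : R, forall x, `|K x| <= M * `|x|.

(* For a bounded linear [K], the vector [w] below exists (Riesz) and is unique. *)
Definition adjoint K v : H := get [set w | forall u, '[K u, v] = '[u, w]].

Definition K_frame K f (A B : R) :=
  [/\ 0 < A, 0 < B &
      forall x,
        let s := (\esum_(j in [set: int]) (`| '[x, f j] | ^+ 2)%:E)%E in
        ((A * `|adjoint K x| ^+ 2)%:E <= s)%E /\
        (s <= (B * `|x| ^+ 2)%:E)%E].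

(* Unconditional sum over the integers: the limit of the net of finite partial
   sums, which exists whenever the upper frame bound holds. *)
Definition frame_op f x : H := summability.sum (fun j => '[x, f j] *: f j).

Definition sigma S u v : R := '[S u, v].

(* [J] is bounded below for a [K]-frame but need not attain its infimum:
   [K K^* f0] lies in the range of [S^(1/2)], not always in that of [S]. *)
Definition J K S (f0 v : H) : R := 2^-1 * sigma S v v - '[K (adjoint K f0), v].

End KFrame.

(* Main.v *)
(* Lower bound: [sigma_S(v, v)] is the frame sum, hence at least [A |K^* v|^2],
   while [<K K^* f0, v> <= |K^* f0| |K^* v|]; minimise the resulting quadratic in
   [|K^* v|].  Upper bound: evaluate [J] at [t f0] with
   [t = |K^* f0|^2 / (B |f0|^2)], which gives the stated quotient with constant
   [- 1/2 <= - 7/32]. *)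
Require Import Defs.
From mathcomp Require Import all_boot all_order all_algebra.
From mathcomp Require Import boolp classical_sets reals ereal topology normedtype.
From mathcomp Require Import sesquilinear finmap cardinality fsbigop esum.
From mathcomp Require Import showcase.summability lra ring.

Import Order.TTheory GRing.Theory Num.Theory.
Import numFieldNormedType.Exports.

Local Open Scope classical_set_scope.
Local Open Scope ring_scope.

(** * Inner product calculus, Riesz representation and the adjoint *)

Section Inner.
Context {R : realType} {H : hilbertType R}.
Implicit Types (u v w : H) (a : R).

Lemma inner_sym u v : '[u, v] = '[v, u].
Proof. by rewrite hermC/= expr0 mul1r. Qed.

Lemma innerDl u v w : '[u + v, w] = '[u, w] + '[v, w].
Proof. exact: linearDl. Qed.

Lemma innerZl a u w : '[a *: u, w] = a * '[u, w].
Proof. exact: linearZl_LR. Qed.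

Lemma innerBl u v w : '[u - v, w] = '[u, w] - '[v, w].
Proof. exact: linearBl. Qed.

Lemma innerZr a u w : '[u, a *: w] = a * '[u, w].
Proof. by rewrite inner_sym innerZl inner_sym. Qed.

Lemma inner_suml (I : Type) (r : seq I) (F : I -> H) w :
  '[\sum_(i <- r) F i, w] = \sum_(i <- r) '[F i, w].
Proof.
apply: (big_morph (fun u => '[u, w])) => [u v|]; first exact: innerDl.
exact: linear0l.
Qed.

Lemma norm2DZ u v a :
  `|u + a *: v| ^+ 2 = `|u| ^+ 2 + 2 * a * '[u, v] + a ^+ 2 * `|v| ^+ 2.
Proof.
rewrite -!innerE innerDl 2!(inner_sym _ (u + _)) !innerDl !innerZl.
by rewrite !(inner_sym _ (a *: v)) !innerZl (inner_sym v u); ring.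
Qed.

(** For [q > 0], evaluate at the minimiser [t = - p / q]; for [q = 0], an affine function that is
    nonnegative everywhere has zero slope. Each Cauchy-Schwarz type inequality below is an
    instance. *)
Lemma quad_discr (p q e : R) : 0 <= q ->
  (forall t, 0 <= q * t ^+ 2 + 2 * t * p + e) -> p ^+ 2 <= e * q.
Proof.
rewrite le0r => /orP[/eqP-> h|q0 h].
  rewrite mulr0; have [->|p0] := eqVneq p 0; first by rewrite expr0n.
  have := h (- (e + 1) / (2 * p)).
  have -> : 2 * (- (e + 1) / (2 * p)) * p = - (e + 1) by field.
  by rewrite mul0r; lra.
have := h (- p / q).
have -> : q * (- p / q) ^+ 2 + 2 * (- p / q) * p + e = (e * q - p ^+ 2) / q.
  by field; rewrite gt_eqF.
by rewrite pmulr_lge0 ?invr_gt0// subr_ge0.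
Qed.

Lemma inner_CS u v : `|'[u, v]| <= `|u| * `|v|.
Proof.
rewrite -(@ler_pXn2r _ 2) ?nnegrE ?mulr_ge0// real_normK ?num_real// exprMn.
apply: quad_discr => [|t]; first by rewrite exprn_ge0.
by have := sqr_ge0 `|u + t *: v|; rewrite norm2DZ; lra.
Qed.

Lemma cvg_inner {T : Type} {F : set_system T} {FF : Filter F}
    (h : T -> H) x v :
  h t @[t --> F] --> x -> '[h t, v] @[t --> F] --> '[x, v].
Proof.
move=> /cvgrPdist_lt hx; apply/cvgrPdist_lt => e e0.
(* The added 1 keeps the denominator positive when [v = 0]. *)
have d0 : 0 < e / (`|v| + 1) by rewrite divr_gt0// ltr_wpDl.
near=> t.
rewrite -innerBl (le_lt_trans (inner_CS _ _))//.
have : `|x - h t| < e / (`|v| + 1) by near: t; exact: hx.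
rewrite ltr_pdivlMr ?ltr_wpDl// => ?.
by rewrite (le_lt_trans _ (_ : `|x - h t| * (`|v| + 1) < e))// ler_wpM2l// lerDl.
Unshelve. all: by end_near. Qed.

(* [|u|^2 - 2 g u] is bounded below; its sublevel sets generate a Cauchy filter
   because [(<u, h> - g h)^2 <= e^2 |h|^2] whenever [u] is [e^2]-close to the
   infimum, and the limit of that filter represents [g]. *)
Lemma riesz (g : H -> R) (M : R) : scalar g ->
  (forall u, `|g u| <= M * `|u|) -> exists w, forall u, g u = '[u, w].
Proof.
move=> glin gM.
have gDZ u v t : g (u + t *: v) = g u + t * g v by rewrite addrC glin addrC.
pose E u := `|u| ^+ 2 - 2 * g u.
have lbE : lbound (range E) (- M ^+ 2).
  move=> _ [u _ <-]; rewrite /E.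
  have := gM u; have := ler_norm (g u); have := sqr_ge0 (`|u| - M).
  by nra.
have infE : has_inf (range E) by split; [exists (E 0), 0|exists (- M ^+ 2)].
pose m := inf (range E).
pose G (e : R) : set H := [set u | E u < m + e ^+ 2].
pose F := filter_from [set e : R | 0 < e] G.
have FF : ProperFilter F.
  apply: filter_from_proper; last first.
    move=> e /= e0; have [_ [u _ <-] ?] := inf_adherent (exprn_gt0 2 e0) infE.
    by exists u.
  apply: filter_from_filter; first by exists 1 => /=.
  move=> i j /= i0 j0; exists (Num.min i j); first by rewrite /= lt_min i0.
  move=> u /= Eu; have p0 : 0 <= Num.min i j by rewrite le_min !ltW.
  have sq k : 0 < k -> Num.min i j <= k -> m + Num.min i j ^+ 2 <= m + k ^+ 2.
    by move=> k0 ik; rewrite lerD2l ler_pXn2r// nnegrE ltW.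
  by split; apply: (lt_le_trans Eu); apply: sq => //; rewrite ge_min lexx ?orbT.
have near_repr e u h : 0 < e -> G e u -> `|'[u, h] - g h| <= e * `|h|.
  move=> e0 Gu.
  rewrite -(@ler_pXn2r _ 2) ?nnegrE ?mulr_ge0 ?(ltW e0)// real_normK ?num_real//.
  rewrite exprMn; apply: quad_discr => [|t]; first by rewrite exprn_ge0.
  (* Comparing [E (u + t *: h) >= m] with [E u < m + e ^+ 2] leaves a quadratic in [t] that is
     nonnegative everywhere; its discriminant bound is the claim. *)
  have : m <= E (u + t *: h) by apply: ge_inf; [case: infE|exists (u + t *: h)].
  by move: Gu; rewrite /G/= /E norm2DZ gDZ; lra.
have FC : cauchy F.
  apply: cauchy_exP => e e0.
  have d0 : 0 < e / 4 by rewrite divr_gt0.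
  have [u Gu] : exists u, G (e / 4) u.
    have [_ [u _ <-] ?] := inf_adherent (exprn_gt0 2 d0) infE.
    by exists u.
  exists u, (e / 4) => // v Gv; rewrite -ball_normE/=.
  set h := u - v.
  (* Both [u] and [v] nearly represent [g]; testing them on their own difference [h] bounds its norm
     by twice [e / 4]. *)
  have : `|h| * `|h| <= e / 2 * `|h|.
    have := near_repr _ _ h d0 Gu; have := near_repr _ _ h d0 Gv.
    have := ler_norm ('[u, h] - g h); have := ler_norm (- ('[v, h] - g h)).
    have : `|h| * `|h| = '[u, h] - '[v, h] by rewrite -innerBl innerE expr2.
    by rewrite normrN; lra.
  have := normr_ge0 h; rewrite le0r => /orP[/eqP->//|h0].
  by rewrite (ler_pM2r h0) => he; apply: (le_lt_trans he); lra.
have /(@cvg_ex H)[w Fw] := @cauchy_cvg H F FF FC.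
exists w => h.
have c1 : '[u, h] @[u --> F] --> '[w, h] by apply: (cvg_inner id _ h Fw).
have c2 : '[u, h] @[u --> F] --> g h.
  apply/cvgrPdist_lt => e e0.
  have d0 : 0 < e / (`|h| + 1) by rewrite divr_gt0// ltr_wpDl.
  exists (e / (`|h| + 1)) => // u Gu.
  rewrite distrC (le_lt_trans (near_repr _ _ h d0 Gu))//.
  by rewrite mulrAC ltr_pdivrMr ?ltr_wpDl// ltr_pM2l// ltrDl.
by rewrite inner_sym; apply: (cvg_unique _ c2 c1); exact: norm_hausdorff.
Qed.

(** Since [adjoint] is defined by choice, its property holds once a candidate exists: Riesz gives
    one for the functional ['[K u, v]] of [u], bounded by [M * |v|]. *)
Lemma adjointE (K : {linear H -> H}) u v : bounded_operator K ->
  '[K u, v] = '[u, adjoint K v].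
Proof.
move=> [M KM]; suff : exists w, forall u, '[K u, v] = '[u, w].
  by move=> /(@getPex _ [set w | forall u, '[K u, v] = '[u, w]]); exact.
apply: (riesz (fun u => '[K u, v]) (M * `|v|)) => [a x y|x].
  by rewrite linearP innerDl innerZl.
by rewrite (le_trans (inner_CS _ _))// mulrAC ler_wpM2r.
Qed.

End Inner.

(* Unconditional sums, and Cauchy-Schwarz for finite sums *)
#[local] Existing Instance totally_filter.

Section Totally.
Context {I : choiceType}.

Lemma partial_sumE (V : zmodType) (x : I -> V) (X : {fset I}) :
  partial_sum x X = \sum_(i <- X) x i.
Proof. by rewrite big_seq_fsetE. Qed.

Lemma partial_sum_setD {V : zmodType} (x : I -> V) {X Y : {fset I}} :
  (X `<=` Y)%fset ->
  partial_sum x Y - partial_sum x X = partial_sum x (Y `\` X)%fset.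
Proof.
move=> XY; rewrite !partial_sumE (big_fsetID _ (mem X) Y)/=.
have -> : [fset i in Y | i \in X]%fset = X.
  by apply/fsetP => i; rewrite !inE/= andbC; apply/andb_idr => /(fsubsetP XY).
have -> : [fset i in Y | i \notin X]%fset = (Y `\` X)%fset.
  by apply/fsetP => i; rewrite !inE/= andbC.
by rewrite addrAC subrr add0r.
Qed.

Lemma partial_sum_le_esum {R : realType} (a : I -> R) (X : {fset I}) :
  ((partial_sum a X)%:E <= \esum_(i in [set: I]) (a i)%:E)%E.
Proof.
apply: esum_ge; exists [set` X]; first by split.
by rewrite -fsbig_seq ?fset_uniq// sumEFin partial_sumE.
Qed.

(** [esum] is a supremum over finite sets, and nonnegative terms make partial sums monotone: once a
    finite set [X] comes within [e] of [s], so does every finite [Y] containing it. *)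
Lemma cvg_partial_sum_esum {R : realType} {a : I -> R} {s : R} :
  (forall i, 0 <= a i) -> (\esum_(i in [set: I]) (a i)%:E = s%:E)%E ->
  partial_sum a @ totally --> s.
Proof.
move=> a0 sE; apply/cvgrPdist_lt => e e0.
have : ((s - e)%:E < \esum_(i in [set: I]) (a i)%:E)%E.
  by rewrite sE lte_fin ltrBlDr ltrDl.
move=> /ereal_sup_gt[_ [_ [/finite_fsetP[X ->] _] <-]].
rewrite -fsbig_seq ?fset_uniq// sumEFin -partial_sumE lte_fin => sX.
exists X => // Y /= XY.
have XleY : partial_sum a X <= partial_sum a Y.
  by rewrite -subr_ge0 (partial_sum_setD _ XY) partial_sumE sumr_ge0.
have := partial_sum_le_esum a Y; rewrite sE lee_fin => Ys.
by rewrite ger0_norm ?subr_ge0//; lra.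
Qed.

End Totally.

Lemma sum_CS {R : realType} {I : Type} (r : seq I) (c d : I -> R) :
  (\sum_(i <- r) c i * d i) ^+ 2 <=
  (\sum_(i <- r) c i ^+ 2) * (\sum_(i <- r) d i ^+ 2).
Proof.
apply: quad_discr => [|t]; first by apply: sumr_ge0 => i _; exact: sqr_ge0.
have : 0 <= \sum_(i <- r) (c i + t * d i) ^+ 2.
  by apply: sumr_ge0 => i _; exact: sqr_ge0.
congr (_ <= _); rewrite mulr_suml mulr_sumr -!big_split/=.
by apply: eq_bigr => i _; ring.
Qed.

(** * Convergence of the frame operator and its quadratic form *)

Section FrameOperator.
Context {R : realType} {H : hilbertType R}.
Variables (f : int -> H) (B : R).
Hypothesis B0 : 0 <= B.
Hypothesis besselP : forall x : H,
  (\esum_(j in [set: int]) (`| '[x, f j] | ^+ 2)%:E <= (B * `|x| ^+ 2)%:E)%E.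

(* By duality: [|w|^2 = sum c_j <w, f_j>], to which Cauchy-Schwarz and the
   Bessel bound for [w] apply. *)
Lemma bessel_synthesis (c : int -> R) (X : {fset int}) :
  `|partial_sum (fun j => c j *: f j) X| ^+ 2 <=
    B * partial_sum (fun j => c j ^+ 2) X.
Proof.
set w := partial_sum _ X.
have wB : \sum_(j <- X) '[w, f j] ^+ 2 <= B * `|w| ^+ 2.
  rewrite -lee_fin; apply: le_trans (besselP w).
  under eq_bigr do rewrite -real_normK ?num_real//.
  by rewrite -partial_sumE; exact: partial_sum_le_esum.
have ww : `|w| ^+ 2 = \sum_(j <- X) c j * '[w, f j].
  rewrite -innerE {1}/w partial_sumE inner_suml; apply: eq_bigr => j _.
  by rewrite innerZl inner_sym.
have c0 : 0 <= \sum_(j <- X) c j ^+ 2 by apply: sumr_ge0 => j _; exact: sqr_ge0.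
(* The case [w = 0] is set apart because the inequality is obtained after multiplication by
   [|w| ^+ 2], which is then cancelled. *)
rewrite partial_sumE; have := sqr_ge0 `|w|; rewrite le0r => /orP[/eqP->|w0].
  by rewrite mulr_ge0.
rewrite -(ler_pM2r w0) -expr2 {1}ww (le_trans (sum_CS _ _ _))//.
by rewrite (mulrC B) -mulrA ler_wpM2l.
Qed.

Lemma esum_frame_fin x : exists2 s : R,
  (\esum_(j in [set: int]) (`| '[x, f j] | ^+ 2)%:E = s%:E)%E &
  s <= B * `|x| ^+ 2.
Proof.
have := besselP x; set s := esum _ _ => sB.
have s0 : (0 <= s)%E by apply: esum_ge0 => j _; rewrite lee_fin sqr_ge0.
have sfin : s \is a fin_num.
  by rewrite fin_real// (lt_le_trans _ s0)// (le_lt_trans sB)// ltry.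
by exists (fine s); [rewrite fineK|rewrite -lee_fin fineK].
Qed.

(** Applied to the terms of [Y] outside [X], [bessel_synthesis] bounds the squared increment by [B]
    times an increment of the convergent frame sum; so the net is Cauchy and completeness
    applies. *)
Lemma frame_op_cvg x :
  partial_sum (fun j => '[x, f j] *: f j) @ totally --> frame_op f x.
Proof.
have [s sE sB] := esum_frame_fin x.
pose a j := `|'[x, f j]| ^+ 2.
have a0 j : 0 <= a j by exact: sqr_ge0.
apply: cauchy_cvg; apply: cauchy_exP => e e0.
have d0 : 0 < e ^+ 2 / (B + 1) by rewrite divr_gt0 ?exprn_gt0// ltr_wpDl.
have /cvgrPdist_lt/(_ _ d0)[X _ Xs] := cvg_partial_sum_esum a0 sE.
exists (partial_sum (fun j => '[x, f j] *: f j) X), X => // Y /= XY.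
rewrite -ball_normE/= distrC partial_sum_setD//.
rewrite -(@ltr_pXn2r _ 2) ?nnegrE ?(ltW e0)//.
apply: (le_lt_trans (bessel_synthesis _ _)).
under [X in _ * partial_sum X _]funext do rewrite -real_normK ?num_real//.
rewrite -(partial_sum_setD _ XY).
have := Xs _ (fsubset_refl X).
have := partial_sum_le_esum a Y; rewrite sE lee_fin => Ys.
move=> /(le_lt_trans (ler_norm _)); rewrite ltr_pdivlMr ?ltr_wpDl// => Xe.
apply: le_lt_trans Xe; rewrite mulrC.
have XY0 : 0 <= partial_sum a Y - partial_sum a X.
  by rewrite partial_sum_setD// partial_sumE sumr_ge0.
by apply: ler_pM => //; rewrite ?lerD2r ?lerDl.
Qed.

(** By continuity of the inner product, [sigma] is the limit of ['[S_X x, x]], where [S_X x] is the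
    partial sum over [X]; these numbers are the partial frame sums. The frame bounds thus become
    bounds on [sigma]. *)
Lemma sigma_frame_op x :
  (\esum_(j in [set: int]) (`| '[x, f j] | ^+ 2)%:E = (sigma (frame_op f) x x)%:E)%E.
Proof.
have [s sE _] := esum_frame_fin x; rewrite sE; congr EFin.
have c1 := cvg_partial_sum_esum (fun j => sqr_ge0 `|'[x, f j]|) sE.
have c2 := cvg_inner (FF := totally_filter) _ _ x (frame_op_cvg x).
suff E : (fun X => '[partial_sum (fun j => '[x, f j] *: f j) X, x]) =
         partial_sum (fun j => `|'[x, f j]| ^+ 2).
  by rewrite E in c2; apply: (cvg_unique _ c1 c2); exact: norm_hausdorff.
apply/funext => X; rewrite !partial_sumE inner_suml; apply: eq_bigr => j _.
by rewrite innerZl (inner_sym (f j)) -expr2 real_normK ?num_real.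
Qed.

End FrameOperator.

(** * Bounds on the infimum of the functional *)

Theorem theorem2p4 (R : realType) (H : hilbertType R)
    (K : {linear H -> H}) (hK : bounded_operator K)
    (f : int -> H) (A B : R) (hf : K_frame K f A B) (hAB : A < B)
    (f0 : H) (hf0 : f0 != 0) :
  let m := inf (range (J K (frame_op f) f0)) in
  [/\ has_inf (range (J K (frame_op f) f0)),
      - (`|adjoint K f0| ^+ 2 / (2 * A)) <= m,
      m <= - (7 / 32) * (`|adjoint K f0| ^+ 4 / (B * `|f0| ^+ 2)) &
      exists2 beta : R, 0 < beta &
        - (7 / 32) * (`|adjoint K f0| ^+ 4 / (B * `|f0| ^+ 2))
          <= - beta * `|adjoint K f0| ^+ 2].
Proof.
have [A0 B0 frameP] := hf => m.
have hB x := (frameP x).2.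
have sigE := sigma_frame_op f B (ltW B0) hB.
have sigA x : A * `|adjoint K x| ^+ 2 <= sigma (frame_op f) x x.
  by rewrite -lee_fin -sigE; exact: (frameP x).1.
have sigB x : sigma (frame_op f) x x <= B * `|x| ^+ 2.
  by rewrite -lee_fin -sigE; exact: hB.
set c := `|adjoint K f0|.
have c0 : 0 <= c by exact: normr_ge0.
have n0 : 0 < `|f0| by rewrite normr_gt0.
have Bn0 : 0 < B * `|f0| ^+ 2 by rewrite mulr_gt0// exprn_gt0.
have lbJ : lbound (range (J K (frame_op f) f0)) (- (c ^+ 2 / (2 * A))).
  move=> _ [v _ <-]; rewrite /J adjointE//.
  have := inner_CS (adjoint K f0) (adjoint K v).
  move=> /(le_trans (ler_norm _)); have := sigA v; rewrite -/c.
  set t := `|adjoint K v|; set i := '[_, _]; set g := sigma _ _ _ => tg ict.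
  (* Completing the square: [A * t ^+ 2 / 2 - c * t] is smallest at [t = c / A]. *)
  have : 0 <= A / 2 * (t - c / A) ^+ 2 by rewrite mulr_ge0 ?sqr_ge0// divr_ge0// ltW.
  have -> : A / 2 * (t - c / A) ^+ 2 = A * t ^+ 2 / 2 - c * t + c ^+ 2 / (2 * A).
    by field; rewrite gt_eqF.
  by lra.
have infJ : has_inf (range (J K (frame_op f) f0)).
  by split; [exists (J K (frame_op f) f0 0), 0|exists (- (c ^+ 2 / (2 * A)))].
split => //; first by apply: lb_le_inf => //; case: infJ.
(* This [t] minimises [B * t ^+ 2 * |f0| ^+ 2 / 2 - t * c ^+ 2], the upper bound for [J] at
   [t *: f0]. *)
- pose t := c ^+ 2 / (B * `|f0| ^+ 2).
  apply: (@le_trans _ _ (J K (frame_op f) f0 (t *: f0))).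
    by apply: ge_inf; [case: infJ|exists (t *: f0)].
  rewrite /J innerZr adjointE// innerE -/c.
  have := sigB (t *: f0); rewrite normrZ exprMn real_normK ?num_real//.
  set g := sigma _ _ _ => gB.
  have q0 : 0 <= c ^+ 4 / (B * `|f0| ^+ 2) by rewrite divr_ge0 ?exprn_ge0// ltW.
  have tc : t * c ^+ 2 = c ^+ 4 / (B * `|f0| ^+ 2).
    by rewrite /t; field; rewrite !gt_eqF.
  have tB : B * (t ^+ 2 * `|f0| ^+ 2) = c ^+ 4 / (B * `|f0| ^+ 2).
    by rewrite /t; field; rewrite !gt_eqF.
  by lra.
(* If [c = 0], both sides vanish and any positive [beta] works; otherwise [beta], which depends on
   [f0], is chosen to give equality. *)
- have [->|cn0] := eqVneq c 0.
    by exists 1 => //; rewrite !expr0n/= mul0r !mulr0.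
  have cp : 0 < c by rewrite lt_neqAle eq_sym cn0.
  exists (7 / 32 * (c ^+ 2 / (B * `|f0| ^+ 2))).
    by rewrite mulr_gt0// ?divr_gt0// exprn_gt0.
  rewrite le_eqVlt; apply/orP; left; apply/eqP; field.
  by rewrite !gt_eqF.
Qed.
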